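(* The language $\mathrm{MIX}=\{w\in\{a,b,c\}^*\mid |w|_a=|w|_b=|w|_c\}$ is not a $1$-DCFL, i.e., it is not generated by any $1$-DCFG.
   Context: Let $\Sigma$ be a finite alphabet and $1\notin\Sigma$ a separator; $\Sigma_1=\Sigma\cup\{1\}$, $\mathrm{rk}(w)=|w|_1$. For $\mathrm{rk}(u)\ge j$, $u\odot_j v$ is obtained from $u$ by replacing its $j$-th occurrence of $1$ by $v$. Given a finite set $N$ of nonterminals with ranks in $\{0,1\}$, $1$-correct terms are built from nonterminals (their rank), words of $\Sigma^*$ (rank $0$), and $1$ (rank $1$) by $(\alpha\cdot\beta)$ (allowed if $\mathrm{rk}\alpha+\mathrm{rk}\beta\le 1$; rank the sum) and $(\alpha\odot_1\beta)$ (allowed if $\mathrm{rk}\alpha\ge1$, $\mathrm{rk}\alpha+\mathrm{rk}\beta\le 2$; rank $\mathrm{rk}\alpha+\mathrm{rk}\beta-1$). Ground terms (no nonterminals) have values in $\Sigma_1^*$ by interpreting $\cdot$ as concatenation and $\odot_1$ as intercalation. A $1$-DCFG $G=\langle N,\Sigma,P,S\rangle$ has $\mathrm{rk}(S)=0$ and finitely many rules $A\to\alpha$ with $\alpha$ a $1$-correct term of rank $\mathrm{rk}(A)$; derivability $\vdash_G$ is the least reflexive transitive relation such that $A\vdash_G C[B]$ and $(B\to\beta)\in P$ imply $A\vdash_G C[\beta]$ for every context $C$ (term with a single variable leaf); $L(G)$ is the set of values of ground terms $\alpha$ with $S\vdash_G\alpha$. A $1$-DCFL is a language $L(G)$ for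 some $1$-DCFG $G$. *)

(* Defs.v *)
From Stdlib Require Import Relations List.
From mathcomp Require Import all_boot.

Set Implicit Arguments.
Unset Strict Implicit.
Unset Printing Implicit Defensive.

Inductive letter : Type := La | Lb | Lc.

(* Sigma_1 = Sigma u {1}: [Some x] is the letter x, [None] is the separator 1. *)
Definition sym := option letter.

Fixpoint ins1 (u v : seq sym) : seq sym :=
  match u with
  | [::] => [::]
  | None :: u' => v ++ u'
  | Some x :: u' => Some x :: ins1 u' v
  end.

Inductive term (N : Type) : Type :=
  | TNT  : N -> term N
  | TWord : seq letter -> term N
  | TOne : term N
  | TCat : term N -> term N -> term N
  | TIns : term N -> term N -> term N.

Arguments TOne {N}.
Arguments TWord {N} _.

Section Terms.
Variables (N : Type) (rk : N -> nat).

Fixpoint trank (t : term N) : nat :=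
  match t with
  | TNT A => rk A
  | TWord _ => 0
  | TOne => 1
  | TCat a b => trank a + trank b
  | TIns a b => trank a + trank b - 1
  end.

Fixpoint correct1 (t : term N) : bool :=
  match t with
  | TNT _ | TWord _ | TOne => true
  | TCat a b => [&& correct1 a, correct1 b & trank a + trank b <= 1]
  | TIns a b => [&& correct1 a, correct1 b, 1 <= trank a & trank a + trank b <= 2]
  end.

Fixpoint ground (t : term N) : bool :=
  match t with
  | TNT _ => false
  | TWord _ | TOne => true
  | TCat a b | TIns a b => ground a && ground b
  end.

(* value of a ground term (nonterminals are given the empty value, irrelevant) *)
Fixpoint tval (t : term N) : seq sym :=
  match t with
  | TNT _ => [::]
  | TWord w => map Some w
  | TOne => [:: None]
  | TCat a b => tval a ++ tval b
  | TIns a b => ins1 (tval a) (tval b)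
  end.

Inductive step (P : list (N * term N)) : term N -> term N -> Prop :=
  | step_root B beta : In (B, beta) P -> step P (TNT B) beta
  | step_catl a a' b : step P a a' -> step P (TCat a b) (TCat a' b)
  | step_catr a b b' : step P b b' -> step P (TCat a b) (TCat a b')
  | step_insl a a' b : step P a a' -> step P (TIns a b) (TIns a' b)
  | step_insr a b b' : step P b b' -> step P (TIns a b) (TIns a b').
End Terms.

Record DCFG1 := {
  NT : finType;
  nrk : NT -> nat;
  nrk_le1 : forall A, nrk A <= 1;
  rules : list (NT * term NT);
  rules_ok : forall A alpha, In (A, alpha) rules ->
                correct1 nrk alpha /\ trank nrk alpha = nrk A;
  start : NT;
  start_rk : nrk start = 0
}.

Definition derives (G : DCFG1) (A : NT G) (alpha : term (NT G)) : Prop :=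
  clos_refl_trans _ (step (rules G)) (TNT A) alpha.

Definition lang (G : DCFG1) (w : seq sym) : Prop :=
  exists alpha, derives (start G) alpha /\ ground alpha /\ tval alpha = w.

Definition cnt (x : letter) (w : seq sym) : nat :=
  count (fun y => match x, y with
                  | La, Some La | Lb, Some Lb | Lc, Some Lc => true
                  | _, _ => false end) w.

Definition MIX (w : seq sym) : Prop :=
  exists u : seq letter, w = map Some u /\
    cnt La w = cnt Lb w /\ cnt Lb w = cnt Lc w.

(* Main.v *)
(** In a derivation of a word of MIX by a 1-DCFG, replacing the yield of a subterm
    by another yield of the same subterm stays within MIX, so all yields of this
    subterm have the same differences between their letter counts.  As there
    are finitely many subterms of rules, every node of every derivation is
    balanced up to a constant D depending on the grammar only.  Hence each word
    of MIX is built, by concatenation and wrapping, from short pieces through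
    factors and pairs of factors all balanced up to D.

    Read a, b, c as plane vectors with a + b + c = 0.  Up to the error D, a
    balanced factor is a closed subcurve, and a balanced pair is a pair of equal
    chords, an outer one and an inner one.  The word a^K b^2K a^3K c^5K b^3K a^K
    draws a simple closed polygon, so it has no nontrivial closed subcurve.
    Going down from the root, the outer chord starts in the middle of the side
    made of the last and the first block, whose direction is a.  The inner
    chord must then cut the corner c^i b^i, the only one whose cone contains
    -a.  This process is stuck before the pair becomes short: at each splitting
    of such a large piece, one of the two parts is again large. *)

From Stdlib Require Import Classical Relations List.
Require Import Defs.
From mathcomp Require Import all_boot zify.

Set Implicit Arguments.
Unset Strict Implicit.
Unset Printing Implicit Defensive.

(** * Balanced pieces of the word a^K b^2K a^3K c^5K b^3K a^K *)

Section BalancedPieces.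
Variables (K : nat) (A B C : nat -> nat).

(* A i, B i, C i are the letter counts of the prefix of length i. *)
Inductive prefix_counts (i : nat) : Prop :=
  | in_a1 of i <= K & A i = i & B i = 0 & C i = 0
  | in_b1 of K <= i & i <= 3 * K & A i = K & B i + K = i & C i = 0
  | in_a2 of 3 * K <= i & i <= 6 * K & A i + 2 * K = i & B i = 2 * K & C i = 0
  | in_c of 6 * K <= i & i <= 11 * K
      & A i = 4 * K & B i = 2 * K & C i + 6 * K = i
  | in_b2 of 11 * K <= i & i <= 14 * K
      & A i = 4 * K & B i + 9 * K = i & C i = 5 * K
  | in_a3 of 14 * K <= i & i <= 15 * K
      & A i + 10 * K = i & B i = 5 * K & C i = 5 * K.

Definition near D m n := m <= n + D /\ n <= m + D.

(* The letter counts of the pair of factors [s, t), [t', s') pairwise differ by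
   at most D; the negative terms are moved to the other side. *)
Definition balanced1 D s t t' s' :=
  near D (A t + A s' + B s + B t') (B t + B s' + A s + A t') /\
  near D (B t + B s' + C s + C t') (C t + C s' + B s + B t').

Definition balanced0 D s s' := balanced1 D s s' s' s'.

Definition large0 s s' := s <= K /\ 14 * K <= s'.

(* In the second case the hole [t, t') is around the corner between the c-block
   and the last b-block.  Once the outer chord has left the two end blocks, the
   hole contains at least K/2 letters b: holes only grow on the way down, and
   it already had about K of them when one end block was exhausted. *)
Definition large1 s t t' s' :=
  large0 s s' /\ (t' <= 11 * K \/ 11 * K <= t) \/
  s <= 3 * K /\ 11 * K <= s' /\ 6 * K <= t <= 11 * K /\
    11 * K <= t' <= 14 * K /\ (large0 s s' \/ 23 * K <= 2 * t').

Variable D : nat.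
Lemma balanced0_widen s s' : balanced0 D s s' -> balanced0 (4 * D) s s'.
Proof. rewrite /balanced0 /balanced1 /near; lia. Qed.

Hypothesis DK : 80 * D < K.
Hypothesis countsP : forall i, i <= 15 * K -> prefix_counts i.

Ltac locate i := case: (countsP (i := i)); [lia | move=> * ; try lia ..].

Lemma counts_c i : 6 * K <= i <= 11 * K ->
  [/\ A i = 4 * K, B i = 2 * K & C i + 6 * K = i].
Proof. by move=> /andP[H1 H2]; locate i; split; lia. Qed.

Lemma counts_b2 i : 11 * K <= i <= 14 * K ->
  [/\ A i = 4 * K, B i + 9 * K = i & C i = 5 * K].
Proof. by move=> /andP[H1 H2]; locate i; split; lia. Qed.

(** A simple closed polygon comes back near its starting point only at its end, so the cut [m] lies
    in the first or the last block. *)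
Lemma split_cat00 s m s' : s <= m -> m <= s' -> s' <= 15 * K ->
  large0 s s' -> balanced0 D s m -> balanced0 D m s' ->
  large0 s m \/ large0 m s'.
Proof.
move=> ? ? ? [? ?] [[? ?] [? ?]] [[? ?] [? ?]]; rewrite /large0.
locate s; locate s'; locate m.
Qed.

(* The slack 4 * D is needed in [split_ins11_one_side]. *)
Lemma split_ins10 s t t' s' : s <= t -> t <= t' -> t' <= s' -> s' <= 15 * K ->
  large0 s s' -> balanced1 D s t t' s' -> balanced0 (4 * D) t t' ->
  large1 s t t' s' \/ large0 t t'.
Proof.
(* The hole is a nearly closed subcurve, hence nearly empty or nearly the whole word. A nearly empty
   hole lies on one side of position [11 * K] or around it. *)
move=> ? ? ? ? [? ?] [[? ?] [? ?]] [[? ?] [? ?]]; rewrite /large1 /large0.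
locate s; locate s'; locate t; locate t'.
Qed.

(** For concatenations, where the second factor of the pair is empty. A hole around the corner is
    excluded: a factor from [s <= 3 * K] into the c-block has at least [K] more letters a than b. *)
Lemma large1_prefix s m s' : s <= m -> m <= s' -> s' <= 15 * K ->
  balanced0 D s m -> large1 s m s' s' -> large0 s m.
Proof.
move=> ? ? ? [[? ?] [? ?]]; rewrite /large1 /large0.
locate s; locate s'; locate m.
Qed.

Lemma large1_suffix s m s' : s <= m -> m <= s' -> s' <= 15 * K ->
  balanced0 D m s' -> large1 s s m s' -> large0 m s'.
Proof.
move=> ? ? ? [[? ?] [? ?]]; rewrite /large1 /large0.
locate s; locate s'; locate m.
Qed.

(** The outer chord is a nonnegative multiple of -a, so the chord of the hole is too, up to the
    error. A hole after [11 * K] has no c; a hole before it with both b and c contains [3 * K]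
    letters a but at most [2 * K] letters b. *)
Lemma hole_short s t t' s' : s <= t -> t <= t' -> t' <= s' -> s' <= 15 * K ->
  large0 s s' -> t' <= 11 * K \/ 11 * K <= t -> balanced1 D s t t' s' ->
  [/\ A t <= A t' <= A t + 3 * D, B t <= B t' <= B t + 3 * D
    & C t <= C t' <= C t + 3 * D].
Proof.
move=> ? ? ? ? [? ?] hole [[? ?] [? ?]].
suff: (A t <= A t' <= A t + 3 * D) /\ (B t <= B t' <= B t + 3 * D) /\
      (C t <= C t' <= C t + 3 * D) by case=> ? [? ?].
case: hole => ?; locate s; locate s'; locate t; locate t'.
Qed.

(** Filling the hole adds at most [3 * D] of each letter, so [[m, m')] is a factor balanced up to
    [4 * D], and the case of a factor inside a pair applies. *)
Lemma split_ins11_one_side s m t t' m' s' :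
  s <= m -> m <= t -> t <= t' -> t' <= m' -> m' <= s' -> s' <= 15 * K ->
  large0 s s' -> t' <= 11 * K \/ 11 * K <= t -> balanced1 D s t t' s' ->
  balanced1 D s m m' s' -> balanced1 D m t t' m' ->
  large1 s m m' s' \/ large1 m t t' m'.
Proof.
move=> sm mt tt' t'm' m's' Ls' big hole balP balO balI.
have [st t's'] : s <= t /\ t' <= s' by lia.
have [/andP[? ?] /andP[? ?] /andP[? ?]] := hole_short st tt' t's' Ls' big hole balP.
have bal0 : balanced0 (4 * D) m m'.
  move: balI => [[? ?] [? ?]].
  by rewrite /balanced0 /balanced1 /near; lia.
have mm' : m <= m' by lia.
have [|big'] := split_ins10 sm mm' m's' Ls' big balO bal0; first by left.
by right; left; split.
Qed.

Lemma split_ins11_across s m t t' m' s' :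
  s <= m -> m <= t -> t <= t' -> t' <= m' -> m' <= s' -> s' <= 15 * K ->
  s <= 3 * K -> 11 * K <= s' -> 6 * K <= t <= 11 * K ->
  11 * K <= t' <= 14 * K -> large0 s s' \/ 23 * K <= 2 * t' ->
  balanced1 D s t t' s' -> balanced1 D m t t' m' ->
  large1 s m m' s' \/ large1 m t t' m'.
Proof.
move=> ? ? ? ? ? ? ? ? tc t'b.
case: (counts_c tc) (counts_b2 t'b) => [t1 t2 t3] [u1 u2 u3].
move: tc t'b => /andP[? ?] /andP[? ?].
move=> + [[a1 a2] [a3 a4]] [[c1 c2] [c3 c4]].
rewrite /large1 /large0.
case: (leqP (6 * K) m) => Hm; last first.
  (* By subtraction the outer pair is balanced up to [2 * D]; it has no c, so it is short. If an end
     block is left here, it was nearly exhausted, and comparing a with b puts [t'] near or beyond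
     [12 * K]. The bound [23 * K <= 2 * t'] in turn forces [m <= 3 * K]: otherwise the whole pair
     has about [3 * K] letters a or more, against about [5 * K / 2] letters b at most. *)
  by case=> [[? ?]|?]; locate s; locate s'; locate m; locate m'.
have mc : 6 * K <= m <= 11 * K by lia.
case: (counts_c mc) => [m1 m2 m3]; rewrite {}m1 {}m2 in c1 c2 c3 c4.
rewrite {}t1 {}t2 {}u1 {}u3 in a1 a2 a3 a4 c1 c2 c3 c4.
case: (leqP m' (14 * K)) => ?.
  by case; [move=> [? ?]|move=> ?]; left; right; lia.
(* The inner pair has about as many b in [[t', 14 * K)] as a in [[14 * K, m')]. The whole pair adds
   at least [3 * K] letters a, but at most [2 * K] letters b. *)
move=> d; exfalso; move: d.
by case=> [[? ?]|?]; locate m'; locate s; locate s'.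
Qed.

Lemma split_ins11 s m t t' m' s' :
  s <= m -> m <= t -> t <= t' -> t' <= m' -> m' <= s' -> s' <= 15 * K ->
  large1 s t t' s' -> balanced1 D s t t' s' ->
  balanced1 D s m m' s' -> balanced1 D m t t' m' ->
  large1 s m m' s' \/ large1 m t t' m'.
Proof.
move=> ? ? ? ? ? ? [[big hole]|[? [? [? [? ?]]]]] ? ? ?.
  exact: (split_ins11_one_side (t := t) (t' := t')).
exact: split_ins11_across.
Qed.

(** Concatenating a factor on the left is wrapping by a pair with empty second factor, so this is an
    instance of the pair-in-pair case. *)
Lemma split_cat01 s m t t' s' :
  s <= m -> m <= t -> t <= t' -> t' <= s' -> s' <= 15 * K ->
  large1 s t t' s' -> balanced1 D s t t' s' ->
  balanced0 D s m -> balanced1 D m t t' s' -> large0 s m \/ large1 m t t' s'.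
Proof.
move=> sm mt tt' t's' Ls' big balP balL balR.
have balO : balanced1 D s m s' s'.
  by move: balL; rewrite /balanced0 /balanced1 /near; lia.
have [big'|] := split_ins11 sm mt tt' t's' (leqnn s')
  Ls' big balP balO balR; last by right.
by left; apply: (large1_prefix (s' := s')) => //; lia.
Qed.

Lemma split_cat10 s t t' m s' :
  s <= t -> t <= t' -> t' <= m -> m <= s' -> s' <= 15 * K ->
  large1 s t t' s' -> balanced1 D s t t' s' ->
  balanced1 D s t t' m -> balanced0 D m s' -> large1 s t t' m \/ large0 m s'.
Proof.
move=> st tt' t'm ms' Ls' big balP balL balR.
have balO : balanced1 D s s m s'.
  by move: balR; rewrite /balanced0 /balanced1 /near; lia.
have [big'|] := split_ins11 (leqnn s) st tt' t'm ms'
  Ls' big balP balO balL; last by left.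
by right; apply: (large1_suffix (s := s)) => //; lia.
Qed.

Lemma large0_short s s' : s' <= s + D -> ~ large0 s s'.
Proof. by rewrite /large0; lia. Qed.

Lemma large1_empty s s' : ~ large1 s s s' s'.
Proof. by rewrite /large1 /large0; lia. Qed.

End BalancedPieces.

(** * Separators and intercalation *)

Definition nsep (v : seq sym) : nat := count (fun y => ~~ isSome y) v.

Lemma ins1_catl (x u v : seq sym) : nsep x = 0 -> ins1 (x ++ u) v = x ++ ins1 u v.
Proof. by rewrite /nsep; elim: x => [|[y|] x IH] //= /IH ->. Qed.

Lemma ins1_catr (u y v : seq sym) : 0 < nsep u -> ins1 (u ++ y) v = ins1 u v ++ y.
Proof.
by rewrite /nsep; elim: u => [|[z|] u IH] //=; [move/IH=> -> | rewrite catA].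
Qed.

Lemma ins1_sep (x y v : seq sym) : nsep x = 0 -> ins1 (x ++ None :: y) v = x ++ v ++ y.
Proof. exact: ins1_catl. Qed.

Lemma nsep_cat u v : nsep (u ++ v) = nsep u + nsep v.
Proof. exact: count_cat. Qed.

Lemma nsep_map_Some u : nsep (map Some u) = 0.
Proof. by rewrite /nsep; elim: u. Qed.

Lemma nsep1P v : nsep v = 1 ->
  exists x y : seq sym, [/\ v = x ++ None :: y, nsep x = 0 & nsep y = 0].
Proof.
rewrite /nsep; elim: v => [|[z|] v IH] //=.
  by case/IH => x [y [-> ? ?]]; exists (Some z :: x), y.
by case=> ?; exists [::], v.
Qed.

Lemma sep_inj (x y x' y' : seq sym) : nsep x = 0 -> nsep x' = 0 ->
  x ++ None :: y = x' ++ None :: y' -> x = x' /\ y = y'.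
Proof.
rewrite /nsep; elim: x x' => [|[z|] x IH] [|[z'|] x'] //=.
  by move=> _ _ [->].
by move=> nx nx' [-> /(IH _ nx nx') [-> ->]].
Qed.

Lemma cnt_cat x u v : cnt x (u ++ v) = cnt x u + cnt x v.
Proof. exact: count_cat. Qed.

Lemma cnt_le_size x u : cnt x u <= size u.
Proof. exact: count_size. Qed.

(** * Big-step semantics of derivations *)

Section Yields.
Variables (N : Type) (P : list (N * term N)).

Inductive yields : term N -> seq sym -> Prop :=
  | yields_nt A alpha v : In (A, alpha) P -> yields alpha v -> yields (TNT A) v
  | yields_word u : yields (TWord u) (map Some u)
  | yields_one : yields TOne [:: None]
  | yields_cat a b u v : yields a u -> yields b v -> yields (TCat a b) (u ++ v)
  | yields_ins a b u v : yields a u -> yields b v -> yields (TIns a b) (ins1 u v).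

Lemma ground_yields t : ground t -> yields t (Defs.tval t).
Proof.
elim: t => //= [u _|_|a IHa b IHb /andP[ga gb]|a IHa b IHb /andP[ga gb]].
- exact: yields_word.
- exact: yields_one.
- by apply: yields_cat; auto.
- by apply: yields_ins; auto.
Qed.

Lemma yields_ntP A v : yields (TNT A) v ->
  exists2 alpha, In (A, alpha) P & yields alpha v.
Proof. by move=> y; inversion y; exists alpha. Qed.

Lemma step_yields t t' v : step P t t' -> yields t' v -> yields t v.
Proof.
move=> st; elim: st v => [A beta inP|a a' b _ IH|a b b' _ IH|a a' b _ IH|a b b' _ IH] v.
- exact: yields_nt.
- by move=> y; inversion y; subst; apply: yields_cat; auto.
- by move=> y; inversion y; subst; apply: yields_cat; auto.
- by move=> y; inversion y; subst; apply: yields_ins; auto.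
- by move=> y; inversion y; subst; apply: yields_ins; auto.
Qed.

Local Notation derive := (clos_refl_trans _ (step P)).

Lemma derive_yields t t' : derive t t' -> ground t' -> yields t (Defs.tval t').
Proof.
move=> d; elim: (clos_rt_rt1n _ _ _ _ d) => [x|x y z xy _ IH] gr.
  exact: ground_yields.
by apply: step_yields xy _; apply: IH.
Qed.

Lemma derive_congr (f : term N -> term N) :
  (forall x y, step P x y -> step P (f x) (f y)) ->
  forall x y, derive x y -> derive (f x) (f y).
Proof.
move=> stepf x y; elim=> [u v /stepf|u|u v w _ IH _ IH'].
- exact: rt_step.
- exact: rt_refl.
- exact: rt_trans IH IH'.
Qed.

Lemma yields_derive t v : yields t v ->
  exists alpha, [/\ derive t alpha, ground alpha & Defs.tval alpha = v].
Proof.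
elim=> [A alpha w inP _ [beta [d g <-]]|u||a b u w _ [a' [da ga <-]] _ [b' [db gb <-]]
       |a b u w _ [a' [da ga <-]] _ [b' [db gb <-]]].
- exists beta; split=> //; apply: rt_trans d.
  exact/rt_step/step_root.
- by exists (TWord u); split=> //; exact: rt_refl.
- by exists TOne; split=> //; exact: rt_refl.
- exists (TCat a' b'); split=> //=; last by rewrite ga.
  apply: (rt_trans _ _ _ (TCat a' b)).
    by apply: (derive_congr (f := fun x => TCat x b)) da => *; exact: step_catl.
  by apply: derive_congr db => *; exact: step_catr.
- exists (TIns a' b'); split=> //=; last by rewrite ga.
  apply: (rt_trans _ _ _ (TIns a' b)).
    by apply: (derive_congr (f := fun x => TIns x b)) da => *; exact: step_insl.
  by apply: derive_congr db => *; exact: step_insr.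
Qed.

(** The bound covers all subterms because every node is compared with a short yield. It is
    conditional since a subterm may have no yield; its existence is therefore proved classically. *)
Fixpoint short_yields D (t : term N) : Prop :=
  ((exists v, yields t v) -> exists2 v, yields t v & size v <= D) /\
  match t with
  | TCat a b | TIns a b => short_yields D a /\ short_yields D b
  | _ => True
  end.

Lemma short_yields_self D t : short_yields D t ->
  (exists v, yields t v) -> exists2 v, yields t v & size v <= D.
Proof. by case: t => [?|?||? ?|? ?] []. Qed.

Lemma short_yields_leq D D' t : D <= D' -> short_yields D t -> short_yields D' t.
Proof.
move=> DD'.
have mono u : ((exists v, yields u v) -> exists2 v, yields u v & size v <= D) ->
    (exists v, yields u v) -> exists2 v, yields u v & size v <= D'.
  by move=> H /H [v yv sv]; exists v => //; exact: leq_trans DD'.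
elim: t => [?|?||a IHa b IHb|a IHa b IHb] /= [/mono H].
all: by [split | case=> /IHa ? /IHb ?; split].
Qed.

Lemma short_yields_exists t : exists D, short_yields D t.
Proof.
have self u : exists D,
    (exists v, yields u v) -> exists2 v, yields u v & size v <= D.
  have [[v yv]|no] := classic (exists v, yields u v); last by exists 0 => /no.
  by exists (size v) => _; exists v.
have join (a b : term N) u : (exists D, short_yields D a) ->
    (exists D, short_yields D b) ->
    exists D, ((exists v, yields u v) -> exists2 v, yields u v & size v <= D) /\
              (short_yields D a /\ short_yields D b).
  move=> [Da Ha] [Db Hb]; have [Du Hu] := self u.
  exists (Da + Db + Du); split.
    by move=> /Hu [v yv sv]; exists v => //; lia.
  by split; [apply: short_yields_leq Ha | apply: short_yields_leq Hb]; lia.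
elim: t => [A|u||a IHa b IHb|a IHa b IHb] /=; try exact: join.
- by have [D H] := self (TNT A); exists D.
- by have [D H] := self (TWord u); exists D.
- by have [D H] := self TOne; exists D.
Qed.

Lemma short_yields_list (l : list (N * term N)) :
  exists D, forall A alpha, In (A, alpha) l -> short_yields D alpha.
Proof.
elim: l => [|[A0 alpha0] l [D H]]; first by exists 0.
have [D0 H0] := short_yields_exists alpha0; exists (D0 + D) => A alpha /= [[_ <-]|/H].
  by apply: short_yields_leq H0; lia.
by apply: short_yields_leq; lia.
Qed.

Section Rank.
Variable rk : N -> nat.
Hypothesis rk_le1 : forall A, rk A <= 1.
Hypothesis P_ok : forall A alpha, In (A, alpha) P ->
  correct1 rk alpha /\ trank rk alpha = rk A.

Lemma trank_le1 t : correct1 rk t -> trank rk t <= 1.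
Proof.
elim: t => //= [a _ b _ /and3P[_ _ //]|a _ b _ /and4P[_ _ _]].
by lia.
Qed.

Lemma yields_nsep t v : yields t v -> correct1 rk t -> nsep v = trank rk t.
Proof.
elim=> [A alpha w inP _ IH _|u _|_|a b u w _ IHa _ IHb|a b u w ya IHa _ IHb] //=.
- by have [c <-] := P_ok inP; exact: IH.
- exact: nsep_map_Some.
- by case/and3P=> ca cb _; rewrite nsep_cat IHa ?IHb.
- case/and4P=> ca cb a1 ab; move: (IHa ca) (IHb cb) (trank_le1 ca) => ea eb la.
  have /nsep1P [x [y [eu x0 y0]]] : nsep u = 1 by lia.
  by rewrite eu ins1_sep // !nsep_cat x0 y0 eb; lia.
Qed.
End Rank.
End Yields.

(** * A word of MIX without balanced decomposition *)

Definition mix_word K : seq sym :=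
  map Some (nseq K La ++ nseq (2 * K) Lb ++ nseq (3 * K) La ++
            nseq (5 * K) Lc ++ nseq (3 * K) Lb ++ nseq K La).

Lemma size_mix_word K : size (mix_word K) = 15 * K.
Proof. by rewrite size_map !size_cat !size_nseq; lia. Qed.

Lemma mix_word_MIX K : MIX (mix_word K).
Proof.
eexists; split; first by [].
by rewrite /cnt /mix_word !map_cat !map_nseq !count_cat !count_nseq /=; lia.
Qed.

Lemma count_take_nseq_cat (T : Type) (q : pred T) i n y v :
  count q (take i (nseq n y ++ v)) = q y * minn i n + count q (take (i - n) v).
Proof.
rewrite take_cat size_nseq; case: ltnP => [lt_in|le_ni].
  rewrite take_nseq ?(ltnW lt_in) // count_nseq.
  have -> : i - n = 0 by lia.
  by rewrite take0 addn0.
by rewrite count_cat count_nseq.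
Qed.

Lemma mix_word_counts K i : i <= 15 * K ->
  prefix_counts K (fun j => cnt La (take j (mix_word K)))
    (fun j => cnt Lb (take j (mix_word K)))
    (fun j => cnt Lc (take j (mix_word K))) i.
Proof.
move=> Li.
have E x : cnt x (take i (mix_word K)) =
    cnt x [:: Some La] * minn i K + cnt x [:: Some Lb] * minn (i - K) (2 * K) +
    cnt x [:: Some La] * minn (i - 3 * K) (3 * K) +
    cnt x [:: Some Lc] * minn (i - 6 * K) (5 * K) +
    cnt x [:: Some Lb] * minn (i - 11 * K) (3 * K) +
    cnt x [:: Some La] * minn (i - 14 * K) K.
  rewrite /cnt /mix_word !map_cat !map_nseq !count_take_nseq_cat.
  rewrite -[nseq K (Some La)]cats0 count_take_nseq_cat /= !addn0 !addnA.
  by repeat congr (_ + _); congr (_ * minn _ _); lia.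
have := (E La, E Lb, E Lc) => /= [[[EA EB] EC]].
have [H|H] := leqP i K; first by apply: in_a1; lia.
have [H1|H1] := leqP i (3 * K); first by apply: in_b1; lia.
have [H2|H2] := leqP i (6 * K); first by apply: in_a2; lia.
have [H3|H3] := leqP i (11 * K); first by apply: in_c; lia.
have [H4|H4] := leqP i (14 * K); first by apply: in_b2; lia.
by apply: in_a3; lia.
Qed.

(** * Nodes of a derivation of the word: balance and absence of large pieces *)

Section Nodes.
Variables (N : Type) (rk : N -> nat) (P : list (N * term N)).
Hypothesis rk_le1 : forall A, rk A <= 1.
Hypothesis P_ok : forall A alpha, In (A, alpha) P ->
  correct1 rk alpha /\ trank rk alpha = rk A.
Variables K D : nat.
Hypothesis DK : 80 * D < K.
Hypothesis shortP : forall A alpha, In (A, alpha) P -> short_yields P D alpha.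

Local Notation w := (mix_word K).
Local Notation w_balanced0 := (balanced0 (fun j => cnt La (take j w))
  (fun j => cnt Lb (take j w)) (fun j => cnt Lc (take j w)) D).
Local Notation w_balanced1 := (balanced1 (fun j => cnt La (take j w))
  (fun j => cnt Lb (take j w)) (fun j => cnt Lc (take j w)) D).

(** A position in a derivation is recorded only by the words around it, which is all that exchanging
    yields requires. *)
Definition context0 t (p r : seq sym) := forall v, yields P t v -> MIX (p ++ v ++ r).
Definition context1 t (p h r : seq sym) :=
  forall v, yields P t v -> MIX (p ++ ins1 v h ++ r).

Lemma MIX_cnt u : MIX u -> cnt La u = cnt Lb u /\ cnt Lb u = cnt Lc u.
Proof. by case=> ? [_]. Qed.

Lemma cnt_take_prefix x n u z : u ++ z = w -> n = size u ->
  cnt x (take n w) = cnt x u.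
Proof. by move=> <- ->; rewrite take_size_cat. Qed.

(* Replacing v by the short word v0 stays within MIX, so v and v0 have the same
   letter differences. *)
Lemma context0_balanced t v p r : short_yields P D t -> yields P t v ->
  context0 t p r -> p ++ v ++ r = w -> w_balanced0 (size p) (size p + size v).
Proof.
move=> sh yv ctx e.
have [|v0 yv0 sv0] := short_yields_self sh; first by exists v.
have [e1 e2] := MIX_cnt (ctx _ yv); have [e3 e4] := MIX_cnt (ctx _ yv0).
have ct x : cnt x (take (size p + size v) w) = cnt x p + cnt x v.
  by rewrite -cnt_cat; apply: (@cnt_take_prefix x _ _ r); rewrite ?size_cat -?catA.
have cs x : cnt x (take (size p) w) = cnt x p by apply: cnt_take_prefix e _.
have := (cnt_le_size La v0, cnt_le_size Lb v0, cnt_le_size Lc v0) => -[[l1 l2] l3].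
rewrite !cnt_cat in e1 e2 e3 e4.
by rewrite /balanced0 /balanced1 /near !ct !cs; lia.
Qed.

(** The same exchange in rank one. The rank fixes the number of separators, so the short yield also
    splits into two parts around [h], together with at most [D] of each letter. *)
Lemma context1_balanced t (x y p h r : seq sym) : short_yields P D t -> correct1 rk t ->
  nsep x = 0 -> nsep y = 0 -> yields P t (x ++ None :: y) ->
  context1 t p h r -> p ++ x ++ h ++ y ++ r = w ->
  w_balanced1 (size p) (size p + size x) (size p + size x + size h)
    (size p + size x + size h + size y).
Proof.
move=> sh ct x0 y0 yv ctx e.
have [|v0 yv0 sv0] := short_yields_self sh; first by eexists; exact: yv.
have n1 : nsep v0 = 1.
  rewrite (yields_nsep rk_le1 P_ok yv0 ct) -(yields_nsep rk_le1 P_ok yv ct).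
  by rewrite nsep_cat x0 /= /nsep /= -/(nsep y) y0.
have [x' [y' [ev0 x'0 y'0]]] := nsep1P n1; subst v0.
have := MIX_cnt (ctx _ yv0); have := MIX_cnt (ctx _ yv).
rewrite !ins1_sep // !cnt_cat => -[e1 e2] [e3 e4].
have cs z : cnt z (take (size p) w) = cnt z p by apply: cnt_take_prefix e _.
have c1 z : cnt z (take (size p + size x) w) = cnt z p + cnt z x.
  rewrite -cnt_cat; apply: (@cnt_take_prefix z _ _ (h ++ y ++ r)).
    by rewrite -catA.
  by rewrite size_cat.
have c2 z : cnt z (take (size p + size x + size h) w) = cnt z p + cnt z x + cnt z h.
  rewrite -!cnt_cat; apply: (@cnt_take_prefix z _ _ (y ++ r)).
    by rewrite -!catA.
  by rewrite !size_cat.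
have c3 z : cnt z (take (size p + size x + size h + size y) w) =
    cnt z p + cnt z x + cnt z h + cnt z y.
  rewrite -!cnt_cat; apply: (@cnt_take_prefix z _ _ r).
    by rewrite -!catA.
  by rewrite !size_cat.
have l z : cnt z x' + cnt z y' <= D.
  apply: leq_trans sv0; rewrite size_cat /=.
  by move: (cnt_le_size z x') (cnt_le_size z y'); lia.
move: (l La) (l Lb) (l Lc) => l1 l2 l3.
by rewrite /balanced1 /near !c1 !c2 !c3 !cs; lia.
Qed.

(** Quantifying over all contexts lets the induction hypothesis for one operand be used in the
    context enlarged by the yield of the other. *)
Definition not_large t v : Prop :=
  (nsep v = 0 -> forall p r, context0 t p r -> p ++ v ++ r = w ->
    ~ large0 K (size p) (size p + size v)) /\
  (forall x y : seq sym, v = x ++ None :: y -> nsep x = 0 -> nsep y = 0 ->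
    forall p h r, context1 t p h r -> p ++ x ++ h ++ y ++ r = w ->
    ~ large1 K (size p) (size p + size x) (size p + size x + size h)
        (size p + size x + size h + size y)).

Lemma yields_nsep_eq t u v : correct1 rk t -> yields P t u -> yields P t v ->
  nsep u = nsep v.
Proof.
by move=> ct yu yv; rewrite (yields_nsep rk_le1 P_ok yu) //
  (yields_nsep rk_le1 P_ok yv).
Qed.

Lemma not_large_cat a b u v : yields P a u -> yields P b v ->
  short_yields P D (TCat a b) -> correct1 rk (TCat a b) ->
  not_large a u -> not_large b v -> not_large (TCat a b) (u ++ v).
Proof.
move=> ya yb sh ct [IHa0 IHa1] [IHb0 IHb1].
have cntsP := @mix_word_counts K.
case/and3P: (ct) => ca cb _; case: (sh) => _ [sa sb].
have na v' := @yields_nsep_eq a v' u ca ^~ ya.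
have yab := yields_cat ya yb.
split=> [|x y euv x0 y0 p h r ctx e big].
  rewrite nsep_cat => /eqP; rewrite addn_eq0 => /andP[/eqP u0 /eqP v0] p r ctx e big.
  have ctxa : context0 a p (v ++ r).
    by move=> v' y'; rewrite (catA v'); apply/ctx/yields_cat.
  have ctxb : context0 b (p ++ u) r.
    by move=> v' y'; rewrite -catA (catA u); apply/ctx/yields_cat.
  have ea : p ++ u ++ v ++ r = w by rewrite -e -catA.
  have eb : (p ++ u) ++ v ++ r = w by rewrite -ea -catA.
  have bala := context0_balanced sa ya ctxa ea.
  have balb := context0_balanced sb yb ctxb eb.
  have := IHa0 u0 _ _ ctxa ea; have := IHb0 v0 _ _ ctxb eb.
  have := congr1 size ea; rewrite size_mix_word.
  move: big balb; rewrite !size_cat !addnA => big balb sz nb na'.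
  by case: (split_cat00 DK cntsP _ _ _ big bala balb) => //; lia.
have := congr1 size e; rewrite size_mix_word !size_cat !addnA => sz.
have nuv : nsep u + nsep v = 1.
  by rewrite -nsep_cat euv nsep_cat x0 /nsep /= -/(nsep y) y0.
have balP : w_balanced1 (size p) (size p + size x) (size p + size x + size h)
    (size p + size x + size h + size y).
  by apply: context1_balanced sh ct x0 y0 _ ctx e; rewrite -euv.
have [u0|u_gt0] := posnP (nsep u).
  have [x' [y' [ev x'0 y'0]]] : exists x' y' : seq sym,
    [/\ v = x' ++ None :: y', nsep x' = 0 & nsep y' = 0] by apply: nsep1P; lia.
  subst v; rewrite catA in euv.
  have [ex ey] : u ++ x' = x /\ y' = y by apply: sep_inj euv; rewrite // nsep_cat u0.
  subst x y.
  have ctxa : context0 a p (x' ++ h ++ y' ++ r).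
    move=> v' yv'; have := ctx _ (yields_cat yv' yb).
    have v'0 : nsep v' = 0 by rewrite (na _ yv').
    by rewrite ins1_catl // ins1_sep // -!catA.
  have ctxb : context1 b (p ++ u) h r.
    move=> v' yv'; have := ctx _ (yields_cat ya yv').
    by rewrite ins1_catl // -!catA.
  have ea : p ++ u ++ x' ++ h ++ y' ++ r = w by rewrite -e -!catA.
  have eb : (p ++ u) ++ x' ++ h ++ y' ++ r = w by rewrite -ea -!catA.
  have bala := context0_balanced sa ya ctxa ea.
  have balb := context1_balanced sb cb x'0 y'0 yb ctxb eb.
  have := IHa0 u0 _ _ ctxa ea; have := IHb1 _ _ erefl x'0 y'0 _ _ _ ctxb eb.
  move: big balP balb sz; rewrite !size_cat !addnA => big balP balb sz nb na'.
  by case: (split_cat01 DK cntsP _ _ _ _ _ big balP bala balb) => //; lia.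
have [x' [y' [eu x'0 y'0]]] : exists x' y' : seq sym,
  [/\ u = x' ++ None :: y', nsep x' = 0 & nsep y' = 0] by apply: nsep1P; lia.
have v0 : nsep v = 0 by lia.
subst u; rewrite -catA in euv.
have [ex ey] := sep_inj x'0 x0 euv; subst x y.
have ctxa : context1 a p h (v ++ r).
  move=> v' yv'; have := ctx _ (yields_cat yv' yb).
  by rewrite ins1_catr ?(na _ yv') // -!catA.
have ctxb : context0 b (p ++ x' ++ h ++ y') r.
  move=> v' yv'; have := ctx _ (yields_cat ya yv').
  by rewrite ins1_catr // ins1_sep // -!catA.
have ea : p ++ x' ++ h ++ y' ++ v ++ r = w by rewrite -e -!catA.
have eb : (p ++ x' ++ h ++ y') ++ v ++ r = w by rewrite -ea -!catA.
have bala := context1_balanced sa ca x'0 y'0 ya ctxa ea.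
have balb := context0_balanced sb yb ctxb eb.
have := IHa1 _ _ erefl x'0 y'0 _ _ _ ctxa ea; have := IHb0 v0 _ _ ctxb eb.
move: big balP balb sz; rewrite !size_cat !addnA => big balP balb sz nb na'.
by case: (split_cat10 DK cntsP _ _ _ _ _ big balP bala balb) => //; lia.
Qed.

Lemma not_large_ins a b u v : yields P a u -> yields P b v ->
  short_yields P D (TIns a b) -> correct1 rk (TIns a b) ->
  not_large a u -> not_large b v -> not_large (TIns a b) (ins1 u v).
Proof.
move=> ya yb sh ct [IHa0 IHa1] [IHb0 IHb1].
have cntsP := @mix_word_counts K.
case/and4P: (ct) => ca cb ra _; case: (sh) => _ [sa sb].
have n1 : nsep u = 1.
  by rewrite (yields_nsep rk_le1 P_ok ya ca); move: (trank_le1 rk_le1 ca) ra; lia.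
have na v' := @yields_nsep_eq a v' u ca ^~ ya.
have nb v' := @yields_nsep_eq b v' v cb ^~ yb.
have [x1 [y1 [eu x10 y10]]] := nsep1P n1; subst u.
have yab := yields_ins ya yb.
rewrite ins1_sep // in yab *.
split=> [|x y euv x0 y0 p h r ctx e big].
  rewrite !nsep_cat x10 y10 add0n addn0 => v0 p r ctx e big.
  have ctxa : context1 a p v r.
    by move=> v' yv'; apply: ctx (yields_ins yv' yb).
  have ctxb : context0 b (p ++ x1) (y1 ++ r).
    by move=> v' yv'; have := ctx _ (yields_ins ya yv'); rewrite ins1_sep // -!catA.
  have ea : p ++ x1 ++ v ++ y1 ++ r = w by rewrite -e -!catA.
  have eb : (p ++ x1) ++ v ++ y1 ++ r = w by rewrite -ea -!catA.
  have bala := context1_balanced sa ca x10 y10 ya ctxa ea.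
  have balb := context0_balanced sb yb ctxb eb.
  have := IHa1 _ _ erefl x10 y10 _ _ _ ctxa ea; have := IHb0 v0 _ _ ctxb eb.
  have := congr1 size ea; rewrite size_mix_word.
  move: big balb; rewrite !size_cat !addnA => big balb sz nb' na'.
  by case: (split_ins10 DK cntsP _ _ _ _ big bala (balanced0_widen balb)) => //; lia.
have := congr1 size e; rewrite size_mix_word !size_cat !addnA => sz.
have v1 : nsep v = 1.
  have := congr1 nsep euv.
  by rewrite !nsep_cat x10 y10 x0 /nsep /= -/(nsep y) y0 -/(nsep v); lia.
have [x2 [y2 [ev x20 y20]]] := nsep1P v1; subst v.
have balP : w_balanced1 (size p) (size p + size x) (size p + size x + size h)
    (size p + size x + size h + size y).
  by apply: context1_balanced sh ct x0 y0 _ ctx e; rewrite -euv.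
have [ex ey] : x1 ++ x2 = x /\ y2 ++ y1 = y.
  by apply: sep_inj; rewrite ?nsep_cat ?x10 // -euv -!catA.
subst x y.
(* Seen from [a], the hole holds [h] already wrapped by the yield of [b]. *)
have ctxa : context1 a p (x2 ++ h ++ y2) r.
  move=> v' yv'; have := ctx _ (yields_ins yv' yb).
  have [x' [y' [ev' x'0 y'0]]] : exists x' y' : seq sym,
    [/\ v' = x' ++ None :: y', nsep x' = 0 & nsep y' = 0].
    by apply: nsep1P; rewrite (na _ yv').
  by rewrite ev' !ins1_sep // -catA ins1_catl // cat_cons ins1_sep // -!catA.
have ctxb : context1 b (p ++ x1) h (y1 ++ r).
  move=> v' yv'; have := ctx _ (yields_ins ya yv').
  by rewrite ins1_sep // ins1_catl // ins1_catr ?(nb _ yv') ?v1 // -!catA.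
have ea : p ++ x1 ++ (x2 ++ h ++ y2) ++ y1 ++ r = w by rewrite -e -!catA.
have eb : (p ++ x1) ++ x2 ++ h ++ y2 ++ y1 ++ r = w by rewrite -ea -!catA.
have bala := context1_balanced sa ca x10 y10 ya ctxa ea.
have balb := context1_balanced sb cb x20 y20 yb ctxb eb.
have := IHa1 _ _ erefl x10 y10 _ _ _ ctxa ea.
have := IHb1 _ _ erefl x20 y20 _ _ _ ctxb eb.
move: big balP bala balb sz; rewrite !size_cat !addnA => big balP bala balb sz nb' na'.
by case: (split_ins11 DK cntsP _ _ _ _ _ _ big balP bala balb) => //; lia.
Qed.

Lemma yields_not_large t v : yields P t v -> short_yields P D t ->
  correct1 rk t -> not_large t v.
Proof.
elim=> {t v} [A alpha v inP yv IH|u||a b u v ya IHa yb IHb|a b u v ya IHa yb IHb] sh ct.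
(* A right-hand side is not a subterm of its nonterminal, so its short yields come from [shortP]; it
   inherits the context since its yields are yields of [A]. *)
- have [IH0 IH1] := IH (shortP inP) (proj1 (P_ok inP)); split.
    by move=> v0 p r ctx; apply: IH0 => // v' yv'; apply/ctx/yields_nt/yv'.
  move=> x y ev x0 y0 p h r ctx; apply: IH1 => // v' yv'.
  by apply/ctx/yields_nt/yv'.
- split=> [_ p r ctx e|x y ev].
    apply: (large0_short DK); rewrite size_map leq_add2l.
    (* A constant word is its own only yield, hence itself short. *)
    have [|v yv sv] := short_yields_self sh; first by eexists; constructor.
    by inversion yv; subst v; rewrite size_map in sv.
  by move/(congr1 nsep): ev; rewrite nsep_map_Some nsep_cat /nsep /=; lia.
- split=> // x y ev x0 y0 p h r ctx e.
  have [<- <-] := @sep_inj [::] [::] x y erefl x0 ev.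
  by rewrite /= !addn0; apply: (large1_empty DK).
- case/and3P: (ct) => ca cb _; case: (sh) => _ [sa sb].
  by apply: not_large_cat => //; [apply: IHa | apply: IHb].
- case/and4P: (ct) => ca cb _ _; case: (sh) => _ [sa sb].
  by apply: not_large_ins => //; [apply: IHa | apply: IHb].
Qed.

End Nodes.

Theorem theorem6 : ~ exists G : DCFG1, forall w, lang G w <-> MIX w.
Proof.
case=> G GMIX.
have [D shortP] := short_yields_list (rules G) (rules G).
pose K := (80 * D).+1; have DK : 80 * D < K by exact: ltnSn.
have [alpha [der [gr val]]] := (GMIX _).2 (mix_word_MIX K).
have y := derive_yields der gr; rewrite val in y.
(* The root is taken to be a right-hand side of the start symbol, as [shortP] speaks of right-hand
   sides only. *)
have [beta inP yb] := yields_ntP y.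
have [ok rkb] := rules_ok inP; rewrite start_rk in rkb.
have n0 := yields_nsep (@nrk_le1 G) (@rules_ok G) yb ok; rewrite rkb in n0.
have [nl _] := yields_not_large (@nrk_le1 G) (@rules_ok G) DK shortP yb
  (shortP _ _ inP) ok.
(* This is where the inclusion of the generated language in MIX enters; all other contexts are
   derived from this one. *)
have ctx : context0 (rules G) beta [::] [::].
  move=> v yv; rewrite /= cats0; apply/GMIX.
  have [gamma [d g e]] := yields_derive (yields_nt inP yv).
  by exists gamma.
apply: nl n0 _ _ ctx _ _; first by rewrite cats0.
by rewrite /large0 size_mix_word /=; lia.
Qed.
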